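(* Let $n\geq 3$ be an integer. Then $$t(n,3,6)\leq 2n-3.$$
   Context: All graphs are finite, undirected and simple. Let $G$ be a nontrivial connected graph of order $n$ (i.e. with $n$ vertices). An edge-coloring of $G$ is any assignment of colors to the edges (adjacent edges may receive the same color). A tree $T$ that is a subgraph of $G$ is a rainbow tree if no two edges of $T$ have the same color. For $S\subseteq V(G)$ with $|S|\geq 2$, a rainbow $S$-tree is a rainbow tree $T$ in $G$ with $S\subseteq V(T)$. For an integer $k$ with $2\leq k\leq n$, an edge-coloring of $G$ is a $k$-rainbow coloring if for every $k$-subset $S$ of $V(G)$ there exists a rainbow $S$-tree. The $k$-rainbow index $rx_k(G)$ is the minimum number of colors needed in a $k$-rainbow coloring of $G$. For integers $2\leq k\leq n$ and $\ell\geq 2$, $t(n,k,\ell)$ denotes the minimum size (number of edges) of a connected graph $G$ of order $n$ with $rx_k(G)\leq \ell$ (when such a graph exists). *)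

(* Defs.v *)
From mathcomp Require Import all_boot.

Set Implicit Arguments.
Unset Strict Implicit.
Unset Printing Implicit Defensive.

Record sgraph (V : finType) := SGraph {
  edges : {set {set V}};
  edges_card2 : forall e, e \in edges -> #|e| = 2
}.

Definition adj (V : finType) (F : {set {set V}}) : rel V :=
  [rel x y | [set x; y] \in F].

(* A subgraph is given by its vertex set U and its edge set F.  Since F only   *)
(* joins vertices of U, every F-path starting in U stays inside U, so that     *)
(* connectedness of (U, F) can be expressed by [connect (adj F)].              *)
Definition subgraph (V : finType) (G : sgraph V)
    (U : {set V}) (F : {set {set V}}) : Prop :=
  F \subset edges G /\ (forall e, e \in F -> e \subset U).

Definition connected (V : finType) (U : {set V}) (F : {set {set V}}) : Prop :=
  U != set0 /\ {in U &, forall x y, connect (adj F) x y}.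

(* [ucycle] also accepts the empty cycle and the back-and-forth walk x, y, x;  *)
(* genuine cycles of a simple graph have at least three vertices.              *)
Definition acyclic (V : finType) (F : {set {set V}}) : Prop :=
  forall p : seq V, ucycle (adj F) p -> size p < 3.

Definition tree (V : finType) (U : {set V}) (F : {set {set V}}) : Prop :=
  connected U F /\ acyclic F.

Definition connected_graph (V : finType) (G : sgraph V) : Prop :=
  connected [set: V] (edges G).

(* Colors are natural numbers; a coloring is a function on all vertex sets, of *)
(* which only the values on the edges are ever used.                           *)
Definition coloring (V : finType) := {set V} -> nat.

Definition num_colors (V : finType) (G : sgraph V) (c : coloring V) : nat :=
  size (undup [seq c e | e in edges G]).

Definition rainbow_Stree (V : finType) (G : sgraph V) (c : coloring V)
    (S U : {set V}) (F : {set {set V}}) : Prop :=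
  [/\ subgraph G U F, tree U F, {in F &, injective c} & S \subset U].

Definition rainbow_coloring (V : finType) (k : nat) (G : sgraph V)
    (c : coloring V) : Prop :=
  forall S : {set V}, #|S| = k -> exists U F, rainbow_Stree G c S U F.

Definition is_min (P : nat -> Prop) (m : nat) : Prop :=
  P m /\ forall m', P m' -> m <= m'.

(* rx_k(G) = r *)
Definition is_rainbow_index (V : finType) (k : nat) (G : sgraph V) (r : nat) :
    Prop :=
  is_min (fun q => exists2 c : coloring V,
            rainbow_coloring k G c & num_colors G c = q) r.

(* t(n, k, l) = m; a relation because the minimum need not exist for all       *)
(* values of the parameters.                                                   *)
Definition is_t (n k l m : nat) : Prop :=
  is_min (fun q => exists (V : finType) (G : sgraph V),
            [/\ #|V| = n, connected_graph G,
                exists2 r, is_rainbow_index k G r & r <= l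
              & #|edges G| = q]) m.

(* Main.v *)
(** The fan, a path [v_0, ..., v_p] with every vertex joined to a centre, has
    [2 * (p + 2) - 3] edges.  Colour the spoke of [v_i] by [i] modulo 3 and the
    path edges periodically with three further colours.  Rim vertices whose
    spokes have different colours reach the centre directly.  If two or three
    spoke colours coincide, the smallest may go through its successor and the largest
    through its predecessor: this uses up the other two residues for spokes, and
    the two path edges involved have different colours. *)
Require Import Defs.
From Stdlib Require Import Classical.
From mathcomp Require Import all_boot zify.

Set Implicit Arguments.
Unset Strict Implicit.
Unset Printing Implicit Defensive.

(** [P] need not be decidable, so the descent to a least element relies on excluded middle. It turns
    a witness for [rx_3] or [t], both given as relations, into an actual minimum below it. *)
Lemma ex_is_min (P : nat -> Prop) (q : nat) :
  P q -> exists2 m, is_min P m & m <= q.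
Proof.
elim/ltn_ind: q => q IHq Pq.
have [[r [r_lt Pr]]|no_smaller] := classic (exists r, r < q /\ P r).
  have [m m_min le_mr] := IHq r r_lt Pr.
  by exists m => //; apply: leq_trans le_mr (ltnW r_lt).
exists q => //; split=> // r Pr; rewrite leqNgt; apply/negP => r_lt.
by apply: no_smaller; exists r.
Qed.

Lemma adj_sym (V : finType) (F : {set {set V}}) : symmetric (adj F).
Proof. by move=> x y; rewrite /adj /= setUC. Qed.

(** * Growing rainbow trees leaf by leaf *)

Section Leaf.

Variables (V : finType) (U : {set V}) (F : {set {set V}}) (x y : V).
Hypotheses (sFU : forall e, e \in F -> e \subset U) (xU : x \in U)
  (yU : y \notin U).

Lemma adj_leaf z : adj ([set x; y] |: F) y z -> z = x.
Proof.
rewrite /adj /= => /setU1P[eq_yz|/sFU/subsetP/(_ y)]; last first.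
  by rewrite set21 (negPf yU) => /(_ isT).
have: x \in [set y; z] by rewrite eq_yz set21.
by case/set2P => [eq_xy|->//]; move: yU; rewrite -eq_xy xU.
Qed.

Lemma adj_nonleaf a b :
  a != y -> b != y -> adj ([set x; y] |: F) a b -> adj F a b.
Proof.
rewrite /adj /= => a_y b_y /setU1P[eq_ab|//].
have: y \in [set a; b] by rewrite eq_ab set22.
by rewrite !inE !(eq_sym y) (negPf a_y) (negPf b_y).
Qed.

Lemma acyclic_leaf : acyclic F -> acyclic ([set x; y] |: F).
Proof.
move=> acF p /andP[cyc_p uniq_p].
have [yp|yNp] := boolP (y \in p).
  (* Rotated to start at [y], the cycle has neighbours of [y] in second and in last place. Both
     equal [x], so [x] is repeated unless there are at most two vertices. *)
  have [i q def_p] := rot_to yp.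
  rewrite -(size_rot i) def_p.
  move: cyc_p uniq_p; rewrite -(rot_cycle i) -(rot_uniq i) def_p.
  case: q {def_p} => [//|a q] /=; rewrite rcons_path.
  case/and3P=> /adj_leaf-> _; rewrite adj_sym => /adj_leaf.
  by case/lastP: q => // q b; rewrite last_rcons => ->;
    rewrite mem_rcons inE eqxx andbF.
apply: acF; rewrite /ucycle uniq_p andbT.
apply: sub_in_cycle cyc_p; last by apply/allP => z; exact: id.
by move=> a b ap bp; apply: adj_nonleaf; [move: ap|move: bp];
  apply: contraTneq => ->.
Qed.

Lemma connected_leaf : connected U F -> connected (y |: U) ([set x; y] |: F).
Proof.
case=> _ conF; split; first by apply/set0Pn; exists y; rewrite setU11.
have sub_conn: subrel (connect (adj F)) (connect (adj ([set x; y] |: F))).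
  by apply: connect_sub => a b ab; apply: connect1; apply/setU1P; right.
have to_x z : z \in y |: U -> connect (adj ([set x; y] |: F)) z x.
  case/setU1P => [->|zU]; last by apply: sub_conn; apply: conF.
  by apply: connect1; rewrite adj_sym; apply/setU1P; left.
move=> a b /to_x ax /to_x bx; apply: connect_trans ax _.
by rewrite (sym_connect_sym (adj_sym _)).
Qed.

End Leaf.

(** The list [C] bounds the colours in use, so a leaf can be attached by checking only [U] and [C],
    with the edge set kept hidden. *)
Definition rainbow_tree_on (V : finType) (G : sgraph V) (c : coloring V)
    (U : {set V}) (C : seq nat) : Prop :=
  exists F, [/\ subgraph G U F, tree U F, {in F &, injective c} &
                {in F, forall e, c e \in C}].

Lemma rainbow_tree_on1 (V : finType) (G : sgraph V) (c : coloring V) (u : V) :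
  rainbow_tree_on G c [set u] [::].
Proof.
exists set0; split; [|split; [split|]| |].
- by split=> [|e]; rewrite ?sub0set ?inE.
- by apply/set0Pn; exists u; rewrite set11.
- by move=> a b /set1P-> /set1P->; exact: connect0.
- by case=> [|a [|b q]] //= /andP[]; rewrite /= /adj /= in_set0.
- by move=> e; rewrite inE.
- by move=> e; rewrite inE.
Qed.

Lemma rainbow_tree_on_leaf (V : finType) (G : sgraph V) (c : coloring V)
    (U : {set V}) (C : seq nat) (x y : V) :
    rainbow_tree_on G c U C -> x \in U -> y \notin U ->
    [set x; y] \in edges G -> c [set x; y] \notin C ->
  rainbow_tree_on G c (y |: U) (c [set x; y] :: C).
Proof.
move=> [F [[sFG sFU] [conF acF] injF colF]] xU yU Gxy newc.
have newcF e : e \in F -> c e <> c [set x; y].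
  by move=> /colF eC ce; rewrite -ce eC in newc.
exists ([set x; y] |: F); split; [split|split| |].
- by rewrite subUset sub1set Gxy.
- move=> e /setU1P[->|/sFU sU]; last by rewrite subsetU // sU orbT.
  by rewrite subUset !sub1set setU11 setU1r.
- exact: connected_leaf.
- exact: acyclic_leaf sFU xU yU acF.
- move=> e f /setU1P[->|eF] /setU1P[->|fF] //; last exact: injF.
    by move/esym/newcF; case.
  by move/newcF; case.
- by move=> e /setU1P[->|/colF eC]; rewrite inE ?eqxx // eC orbT.
Qed.

(** * The fan and its colouring with six colours *)

Section Fan.

Variable p : nat.
(** [None] is the centre and [Some i] is the path vertex [v_i]. *)
Notation V := (option 'I_p.+1).

Definition spoke (i : 'I_p.+1) : {set V} := [set None; Some i].
Definition rim (i : 'I_p) : {set V} :=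
  [set Some (widen_ord (leqnSn p) i); Some (lift ord0 i)].

Definition fan_edges : {set {set V}} :=
  [set spoke i | i : 'I_p.+1] :|: [set rim i | i : 'I_p].

Lemma fan_edges_card2 e : e \in fan_edges -> #|e| = 2.
Proof.
case/setUP=> /imsetP[i _ ->]; rewrite cards2 //.
by rewrite (inj_eq Some_inj) -val_eqE /= /bump /= add1n neq_ltn ltnSn.
Qed.

Definition fan : sgraph V := SGraph fan_edges_card2.

Lemma spoke_fan i : [set None; Some i] \in edges fan.
Proof. by apply/setUP; left; apply: imset_f. Qed.

Lemma rim_fan (i j : 'I_p.+1) : j = i.+1 :> nat ->
  [set Some i; Some j] \in edges fan.
Proof.
move=> def_j; have ip : i < p by rewrite -ltnS -def_j.
apply/setUP; right; apply/imsetP; exists (Ordinal ip) => //.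
by congr [set Some _; Some _]; apply: val_inj => //=; rewrite def_j.
Qed.

(** At most [p.+1] spokes and [p] path edges, hence at most [2 * p + 1] edges. *)
Lemma card_fan_edges : #|edges fan| <= 2 * p.+2 - 3.
Proof.
apply: leq_trans (leq_card_setU _ _) _.
apply: leq_trans (leq_add (leq_imset_card _ _) (leq_imset_card _ _)) _.
by rewrite !card_ord; lia.
Qed.

Lemma connected_fan : connected_graph fan.
Proof.
split; first by apply/set0Pn; exists None.
have to_center x : connect (adj (edges fan)) None x.
  by case: x => [i|]; [apply: connect1; exact: spoke_fan|exact: connect0].
move=> x y _ _; apply: connect_trans (to_center y).
by rewrite (sym_connect_sym (adj_sym _)).
Qed.

(** The value 0 at the centre lets one formula colour all edges: positions sum to [i] on the spoke
    of [v_i], and to [2 * i + 1] on the path edge that starts at [v_i]. *)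
Definition position (x : V) : nat := if x is Some i then i else 0.

(* The path edge from [i] to [i + 1] gets [(2 * i + 1) %% 3 + 3], which runs
   through all of 3, 4, 5 because 2 is invertible modulo 3. *)
Definition fan_coloring : coloring V :=
  fun e => (\sum_(x in e) position x) %% 3 + (if None \in e then 0 else 3).

Lemma color_spoke i : fan_coloring [set None; Some i] = i %% 3.
Proof.
by rewrite /fan_coloring set21 addn0 big_setU1 ?inE //= big_set1.
Qed.

Lemma color_rim (i j : 'I_p.+1) : j = i.+1 :> nat ->
  fan_coloring [set Some i; Some j] = (i + j) %% 3 + 3.
Proof.
move=> def_j; rewrite /fan_coloring !inE /= big_setU1 ?big_set1 //.
by rewrite inE (inj_eq Some_inj) -val_eqE /= def_j neq_ltn ltnSn.
Qed.

Lemma num_colors_fan : num_colors fan fan_coloring <= 6.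
Proof.
rewrite -(size_iota 0 6); apply: uniq_leq_size; first exact: undup_uniq.
move=> a; rewrite mem_undup => /imageP[e _ ->].
rewrite mem_iota /fan_coloring; case: ifP => _; lia.
Qed.

(** * Rainbow trees in the fan *)

Definition joined (S : {set V}) : Prop :=
  exists U F, rainbow_Stree fan fan_coloring S U F.

Lemma joined_sub U C (S : {set V}) :
  rainbow_tree_on fan fan_coloring U C -> S \subset U -> joined S.
Proof. by move=> [F [? ? ? _]] sSU; exists U, F. Qed.

Lemma tree_spoke U C (i : 'I_p.+1) :
    rainbow_tree_on fan fan_coloring U C -> None \in U -> Some i \notin U ->
    i %% 3 \notin C ->
  rainbow_tree_on fan fan_coloring (Some i |: U) (i %% 3 :: C).
Proof.
move=> tU U0 Ui Ci; rewrite -color_spoke.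
by apply: rainbow_tree_on_leaf; rewrite ?color_spoke ?spoke_fan.
Qed.

Lemma tree_next U C (i j : 'I_p.+1) : j = i.+1 :> nat ->
    rainbow_tree_on fan fan_coloring U C -> Some i \in U -> Some j \notin U ->
    (i + j) %% 3 + 3 \notin C ->
  rainbow_tree_on fan fan_coloring (Some j |: U) ((i + j) %% 3 + 3 :: C).
Proof.
move=> def_j tU Ui Uj Cij; rewrite -color_rim //.
by apply: rainbow_tree_on_leaf; rewrite ?color_rim ?rim_fan.
Qed.

Lemma tree_prev U C (i j : 'I_p.+1) : j = i.+1 :> nat ->
    rainbow_tree_on fan fan_coloring U C -> Some j \in U -> Some i \notin U ->
    (i + j) %% 3 + 3 \notin C ->
  rainbow_tree_on fan fan_coloring (Some i |: U) ((i + j) %% 3 + 3 :: C).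
Proof.
move=> def_j tU Uj Ui; rewrite -color_rim //.
have -> : [set Some i; Some j] = [set Some j; Some i] by rewrite setUC.
by apply: rainbow_tree_on_leaf; rewrite // setUC rim_fan.
Qed.

(** The larger index [j] ensures that the successor of [i] is still on the path. *)
Lemma ord_next (i j : 'I_p.+1) : i < j -> exists k : 'I_p.+1, k = i.+1 :> nat.
Proof. by move=> ij; exists (Ordinal (leq_ltn_trans ij (ltn_ord j))). Qed.

Lemma ord_prev (i j : 'I_p.+1) : i < j -> exists k : 'I_p.+1, j = k.+1 :> nat.
Proof.
move=> ij; have lt_j := ltn_ord j; have pj : j.-1 < p.+1 by lia.
by exists (Ordinal pj) => /=; lia.
Qed.

Lemma eq_Some (i j : 'I_p.+1) : (Some i == Some j) = (i == j :> nat).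
Proof. by []. Qed.

Lemma eq_Some_None (i : 'I_p.+1) : (Some i == None) = false.
Proof. by []. Qed.

Ltac side := rewrite ?inE ?eqxx ?eq_Some ?eq_Some_None; first [done | lia].

Ltac cover := rewrite !subUset !sub1set !inE !eqxx ?orbT.

Lemma joined_distinct (i j k : 'I_p.+1) :
    i %% 3 != j %% 3 -> i %% 3 != k %% 3 -> j %% 3 != k %% 3 ->
  joined [set None; Some i; Some j; Some k].
Proof.
move=> ij ik jk.
have t0 := rainbow_tree_on1 fan fan_coloring None.
have t1 := @tree_spoke _ _ i t0 ltac:(side) ltac:(side) ltac:(side).
have t2 := @tree_spoke _ _ j t1 ltac:(side) ltac:(side) ltac:(side).
have t3 := @tree_spoke _ _ k t2 ltac:(side) ltac:(side) ltac:(side).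
by apply: (joined_sub t3); cover.
Qed.

Lemma joined_two_alike (i j k : 'I_p.+1) :
    i < j -> i %% 3 = j %% 3 -> k %% 3 != i %% 3 ->
  joined [set None; Some i; Some j; Some k].
Proof.
move=> lt_ij ij ki.
have t0 := rainbow_tree_on1 fan fan_coloring None.
have t1 := @tree_spoke _ _ k t0 ltac:(side) ltac:(side) ltac:(side).
(* One spoke colour stays free beside those of [k] and [i]. If [k] has residue [i + 1], the free one
   is that of [j - 1], so [j] is reached through its predecessor; otherwise it is that of [i + 1],
   and [i] is reached through its successor. *)
have [k_next|k_prev] := eqVneq (k %% 3) (i.+1 %% 3).
  have [j' def_j] := ord_prev lt_ij.
  have t2 := @tree_spoke _ _ i t1 ltac:(side) ltac:(side) ltac:(side).
  have t3 := @tree_spoke _ _ j' t2 ltac:(side) ltac:(side) ltac:(side).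
  have t4 := tree_next def_j t3 ltac:(side) ltac:(side) ltac:(side).
  by apply: (joined_sub t4); cover.
have [i' def_i'] := ord_next lt_ij.
have t2 := @tree_spoke _ _ j t1 ltac:(side) ltac:(side) ltac:(side).
have t3 := @tree_spoke _ _ i' t2 ltac:(side) ltac:(side) ltac:(side).
have t4 := tree_prev def_i' t3 ltac:(side) ltac:(side) ltac:(side).
by apply: (joined_sub t4); cover.
Qed.

(** With common residue [r], the spokes of [j], [i + 1] and [k - 1] have residues [r], [r + 1] and
    [r - 1]. The two path edges have position sums congruent to [2 * r + 1] and [2 * r - 1], which
    differ modulo 3. *)
Lemma joined_three_alike (i j k : 'I_p.+1) :
    i < j -> j < k -> i %% 3 = j %% 3 -> j %% 3 = k %% 3 ->
  joined [set None; Some i; Some j; Some k].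
Proof.
move=> lt_ij lt_jk ij jk.
have [i' def_i'] := ord_next lt_ij.
have [k' def_k] := ord_prev lt_jk.
have t0 := rainbow_tree_on1 fan fan_coloring None.
have t1 := @tree_spoke _ _ j t0 ltac:(side) ltac:(side) ltac:(side).
have t2 := @tree_spoke _ _ i' t1 ltac:(side) ltac:(side) ltac:(side).
have t3 := @tree_spoke _ _ k' t2 ltac:(side) ltac:(side) ltac:(side).
have t4 := tree_prev def_i' t3 ltac:(side) ltac:(side) ltac:(side).
have t5 := tree_next def_k t4 ltac:(side) ltac:(side) ltac:(side).
by apply: (joined_sub t5); cover.
Qed.

(** Serves both to permute the vertices listed in a set and to drop the centre from it. *)
Lemma joinedW (S T : {set V}) : joined T -> S \subset T -> joined S.
Proof.
move=> [U [F [? ? ? sTU]]] sST; exists U, F; split=> //.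
exact: subset_trans sTU.
Qed.

Lemma joined_lt (i j k : 'I_p.+1) : i < j -> j < k ->
  joined [set None; Some i; Some j; Some k].
Proof.
move=> lt_ij lt_jk.
have [ij|ij] := eqVneq (i %% 3) (j %% 3).
  have [jk|jk] := eqVneq (j %% 3) (k %% 3).
    exact: joined_three_alike.
  by apply: joined_two_alike => //; rewrite eq_sym ij.
have [jk|jk] := eqVneq (j %% 3) (k %% 3).
  by apply: joinedW (joined_two_alike lt_jk jk ij) _; cover.
have [ik|ik] := eqVneq (i %% 3) (k %% 3).
  rewrite eq_sym in ij.
  by apply: joinedW (joined_two_alike (ltn_trans lt_ij lt_jk) ik ij) _; cover.
exact: joined_distinct.
Qed.

(** Treated apart from triples of path vertices, since the path may have only two vertices. *)
Lemma joined2 (i j : 'I_p.+1) : i < j -> joined [set None; Some i; Some j].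
Proof.
move=> lt_ij.
have t0 := rainbow_tree_on1 fan fan_coloring None.
have t1 := @tree_spoke _ _ i t0 ltac:(side) ltac:(side) ltac:(side).
have [ij|ij] := eqVneq (i %% 3) (j %% 3).
  have [j' def_j] := ord_prev lt_ij.
  have t2 := @tree_spoke _ _ j' t1 ltac:(side) ltac:(side) ltac:(side).
  have t3 := tree_next def_j t2 ltac:(side) ltac:(side) ltac:(side).
  by apply: (joined_sub t3); cover.
have t2 := @tree_spoke _ _ j t1 ltac:(side) ltac:(side) ltac:(side).
by apply: (joined_sub t2); cover.
Qed.

(** * From ordered triples to arbitrary 3-subsets *)

Lemma joined_neq (i j k : 'I_p.+1) : i != j -> j != k -> i != k ->
  joined [set None; Some i; Some j; Some k].
Proof.
move=> ij jk ik.
wlog lt_ij : i j ij jk ik / i < j => [WH|].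
  case: (ltngtP i j) => [|lt_ji|/val_inj eq_ij]; first exact: WH.
    by apply: joinedW (WH j i _ ik jk lt_ji) _; [rewrite eq_sym|cover].
  by rewrite eq_ij eqxx in ij.
case: (ltngtP j k) => [|lt_kj|/val_inj eq_jk]; first exact: joined_lt.
  case: (ltngtP i k) => [lt_ik|lt_ki|/val_inj eq_ik].
  - by apply: joinedW (joined_lt lt_ik lt_kj) _; cover.
  - by apply: joinedW (joined_lt lt_ki lt_ij) _; cover.
  by rewrite eq_ik eqxx in ik.
by rewrite eq_jk eqxx in jk.
Qed.

Lemma rainbow_fan : rainbow_coloring 3 fan fan_coloring.
Proof.
move=> S cardS; change (joined S).
(* The first element is left free so that the centre can be singled out when it lies in [S]. *)
have split_S x : x \in S ->
    exists y z, [/\ x != y, x != z, y != z & S = [set x; y; z]].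
  move=> xS; have: #|S :\ x| == 2 by move: (cardsD1 x S); rewrite xS cardS; lia.
  case/cards2P=> y [z [yz def_Sx]]; exists y, z.
  have [y_x yS] : y != x /\ y \in S.
    by apply/andP; rewrite -in_setD1 def_Sx set21.
  have [z_x zS] : z != x /\ z \in S.
    by apply/andP; rewrite -in_setD1 def_Sx set22.
  by rewrite ![x == _]eq_sym y_x z_x yz -setUA -def_Sx setD1K.
have [S0|SN0] := boolP (None \in S).
  have [[i|] [[j|] [// _ _ ij ->]]] := split_S None S0.
  case: (ltngtP i j) => [|lt_ji|/val_inj eq_ij]; first exact: joined2.
    by apply: joinedW (joined2 lt_ji) _; cover.
  by rewrite eq_ij eqxx in ij.
have /set0Pn[x xS]: S != set0 by rewrite -card_gt0 cardS.
have [y [z [xy xz yz def_S]]] := split_S x xS.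
move: SN0 xy xz yz; rewrite def_S !inE !negb_or.
case: x {xS def_S} => [i|//]; case: y => [j|//]; case: z => [k|//] _ ij ik jk.
by apply: joinedW (joined_neq ij jk ik) _; cover.
Qed.

End Fan.

Theorem theorem2p10 (n : nat) (hn : 3 <= n) :
  exists2 m : nat, is_t n 3 6 m & m <= 2 * n - 3.
Proof.
(* Here [n = p.+2]: the centre and [p.+1] path vertices. *)
case: n hn => [|[|p]] // _.
(* The colouring bounds the rainbow index of the fan, and the fan in turn bounds [t]. *)
have [r r_min r_le] : exists2 r, is_rainbow_index 3 (fan p) r &
    r <= num_colors (fan p) (@fan_coloring p).
  by apply: ex_is_min; exists (@fan_coloring p) => //; exact: rainbow_fan.
have [m m_min m_le] : exists2 m, is_t p.+2 3 6 m & m <= #|edges (fan p)|.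
  apply: ex_is_min; exists (option 'I_p.+1), (fan p); split=> //.
  - by rewrite card_option card_ord.
  - exact: connected_fan.
  - by exists r => //; exact: leq_trans r_le (num_colors_fan p).
by exists m => //; apply: leq_trans m_le (card_fan_edges p).
Qed.
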